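(* For any real matrix $M$, we have $$\operatorname{rank}(M) \leq \operatorname{rank}_s(M) \leq \operatorname{rank}(M) + 1.$$
   Context: For $M \in \mathbb{R}^{m \times n}$, $\operatorname{rank}(M)$ is the usual rank. The semi-nonnegative rank $\operatorname{rank}_s(M)$ is the smallest $r$ such that there exist $U \in \mathbb{R}^{m \times r}$ and $V \in \mathbb{R}^{r \times n}$ with $M = UV$ and $V \geq 0$, where $V \geq 0$ means that $V$ is component-wise nonnegative (the zero matrix has semi-nonnegative rank $0$). *)

(* Defs.v *)
From mathcomp Require Import all_boot all_order all_algebra.
From mathcomp Require Import boolp reals.

Set Implicit Arguments.
Unset Strict Implicit.
Unset Printing Implicit Defensive.

Import Order.TTheory GRing.Theory Num.Theory.
Local Open Scope ring_scope.

Definition nonneg_mx (R : realType) (m n : nat) (A : 'M[R]_(m, n)) : Prop :=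
  forall i j, 0 <= A i j.

Definition semi_nonneg_factorizable (R : realType) (m n : nat)
    (M : 'M[R]_(m, n)) (r : nat) : Prop :=
  exists (U : 'M[R]_(m, r)) (V : 'M[R]_(r, n)), M = U *m V /\ nonneg_mx V.

Lemma semi_nonneg_factorizable_ex (R : realType) (m n : nat)
    (M : 'M[R]_(m, n)) : exists r, `[< semi_nonneg_factorizable M r >].
Proof.
exists n; apply/asboolP; exists M, 1%:M; split; first by rewrite mulmx1.
by move=> i j; rewrite mxE ler0n.
Qed.

(* A factorization with r = 0 exists exactly when M = 0, since the product
   through an empty dimension is the zero matrix. *)
Definition semi_nonneg_rank (R : realType) (m n : nat) (M : 'M[R]_(m, n)) :
    nat :=
  ex_minn (semi_nonneg_factorizable_ex M).

(* Main.v *)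
Require Import Defs.
From mathcomp Require Import all_boot all_order all_algebra.
From mathcomp Require Import boolp reals.

(* Lower bound: a product through r dimensions has rank at most r.
   Upper bound: let M = A B be a full-rank factorization and let c bound the
   entries of B in absolute value. Adding c to every entry of B makes it
   nonnegative and changes the product by c A 1 1^T, a matrix of rank at most
   one whose right factor, the row of ones, is nonnegative; subtracting it
   costs one extra inner dimension. *)

Import Order.TTheory GRing.Theory Num.Theory.

Lemma mxrank_semi_nonneg_factorizable (R : realType) (m n r : nat)
    (M : 'M[R]_(m, n)) : semi_nonneg_factorizable M r -> (\rank M <= r)%N.
Proof.
case=> U [V [-> _]].
exact: leq_trans (mxrankM_maxl U V) (rank_leq_col U).
Qed.

Lemma mx_entries_bounded (R : realType) (m n : nat) (A : 'M[R]_(m, n)) :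
  exists c : R, forall i j, (`|A i j| <= c)%R.
Proof.
(* The sum of all absolute values, unlike a maximum, also makes sense for an empty matrix. *)
exists (\sum_i \sum_j `|A i j|)%R => i j.
rewrite (bigD1 i) //= (bigD1 j) //= -addrA lerDl addr_ge0 //.
  exact: sumr_ge0.
by apply: sumr_ge0 => k _; apply: sumr_ge0.
Qed.

Lemma semi_nonneg_factorizable_mulmx (R : realType) (m n r : nat)
    (A : 'M[R]_(m, r)) (B : 'M[R]_(r, n)) :
  semi_nonneg_factorizable (A *m B)%R (r + 1).
Proof.
have [c Bc] := mx_entries_bounded _ _ _ B.
(* [u *m v] is the matrix with all entries [c]. *)
pose u : 'cV[R]_r := const_mx c; pose v : 'rV[R]_n := const_mx 1%R.
exists (row_mx A (- (A *m u)))%R, (col_mx (B + u *m v) v)%R; split.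
  by rewrite mul_row_col mulmxDr mulNmx mulmxA addrK.
move=> i j; rewrite mxE; case: split => k; rewrite !mxE ?ler01 //.
(* What remains is the upper block, with entries [B k j + c]. *)
rewrite big_ord1 !mxE mulr1.
by have := Bc k j; rewrite ler_norml => /andP[Bc_ge _]; rewrite -lerBlDr sub0r.
Qed.

Theorem corollary1 (R : realType) (m n : nat) (M : 'M[R]_(m, n)) :
  (\rank M <= semi_nonneg_rank M <= \rank M + 1)%N.
Proof.
rewrite /semi_nonneg_rank; case: ex_minnP => r /asboolP Mr min_r.
rewrite mxrank_semi_nonneg_factorizable //=; apply: min_r; apply/asboolP.
(* Only the matrix to be factored is rewritten, as [col_base M *m row_base M]; its inner dimension
   is [\rank M]. *)
rewrite -{1}(mulmx_base M); exact: semi_nonneg_factorizable_mulmx.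
Qed.
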